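(* Let $A$ and $B$ be finite-dimensional quantum systems. There exists a 1-slot virtual comb $\widetilde{\mathcal{C}}$ that universally implements the complex conjugate, i.e., $\widetilde{\mathcal{C}}(\mathcal{N})=\mathcal{N}^*$ for all quantum channels $\mathcal{N}\in\mathrm{CPTP}(A,B)$.
   Context: A quantum system $A$ is a $d_A$-dimensional complex Hilbert space with a fixed orthonormal basis; $\mathscr{L}_A$ is the space of linear operators on it. $\mathrm{CPTP}(A,B)$ is the set of quantum channels, i.e. completely positive trace-preserving linear maps $\mathscr{L}_A\to\mathscr{L}_B$. For a channel with Kraus representation $\mathcal{N}(\cdot)=\sum_j K_j(\cdot)K_j^\dagger$, its complex conjugate is $\mathcal{N}^*(\cdot)=\sum_j K_j^*(\cdot)K_j^{\mathsf T}$ (complex conjugate and transpose in the fixed bases). The Choi operator of a linear map $\mathcal{N}:\mathscr{L}_A\to\mathscr{L}_B$ is $\mathsf{N}_{AB}=\sum_{i,j}|i\rangle\langle j|\otimes\mathcal{N}(|i\rangle\langle j|)$; the Choi operator of $\mathcal{N}^*$ is $\mathsf{N}_{AB}^{\mathsf T}$. A 1-slot linear supermap $\mathcal{C}$ from maps $\mathscr{L}_A\to\mathscr{L}_B$ to maps $\mathscr{L}_{A'}\to\mathscr{L}_{B'}$ (here $A'\cong A$, $B'\cong B$) is specified by its Choi operator $\mathsf{C}_{A'ABB'}$: the Choi operator of $\mathcal{C}(\mathcal{N})$ on $A'B'$ is $\mathrm{Tr}_{AB}\big[\mathsf{C}_{A'ABB'}(\mathsf{N}_{AB}^{\mathsf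 T}\otimes\mathbb{1}_{A'B'})\big]$. It is a 1-slot quantum comb if $\mathsf{C}_{A'ABB'}\ge 0$, $\mathrm{Tr}_{B'}\mathsf{C}_{A'ABB'}=\mathrm{Tr}_{BB'}\mathsf{C}_{A'ABB'}\otimes\frac{\mathbb{1}_B}{d_B}$, and $\mathrm{Tr}_{AB'}\mathsf{C}_{A'ABB'}=\mathbb{1}_{A'B}$. A 1-slot virtual comb is a supermap of the form $\widetilde{\mathcal{C}}=\sum_i\alpha_i\mathcal{C}_i$ (finite sum) with $\alpha_i\in\mathbb{R}$, $\sum_i\alpha_i=1$, and each $\mathcal{C}_i$ a 1-slot quantum comb. *)

(* Defs.v *)
From HB Require Import structures.
From mathcomp Require Export all_boot all_order all_algebra.
From mathcomp Require Export reals.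
From mathcomp Require Export complex mxtens.

Set Implicit Arguments.
Unset Strict Implicit.
Unset Printing Implicit Defensive.

Import Order.TTheory GRing.Theory Num.Theory.
Local Open Scope ring_scope.
Local Open Scope complex_scope.
Local Open Scope sesquilinear_scope.

(* A quantum system of dimension d is C^d with its canonical basis, and the   *)
(* operators from C^m to C^n are the matrices 'M_(n, m) acting on column      *)
(* vectors. Tensor products are ordered from left to right, and               *)
(* mxtens_index (i, j) : 'I_(m * n) is the index of |i>|j>.                   *)

Section Operators.
Variable R : realType.
Local Notation C := R[i].

(* The order of R[i] only compares numbers with equal imaginary parts, so     *)
(* that 0 <= z entails that z is real, and psdmx A that A is Hermitian.       *)
Definition psdmx n (A : 'M[C]_n) : Prop :=
  forall u : 'cV[C]_n, 0 <= (u ^t Num.conj *m A *m u) 0 0.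

Definition ptrace_l m n (A : 'M[C]_(m * n)) : 'M[C]_n :=
  \matrix_(i, j) \sum_(k < m) A (mxtens_index (k, i)) (mxtens_index (k, j)).

Definition ptrace_r m n (A : 'M[C]_(m * n)) : 'M[C]_m :=
  \matrix_(i, j) \sum_(k < n) A (mxtens_index (i, k)) (mxtens_index (j, k)).

(* The partial trace over the middle factor of (C^m (x) C^n) (x) C^p.         *)
Definition ptrace_m m n p (A : 'M[C]_(m * n * p)) : 'M[C]_(m * p) :=
  \matrix_(i, j)
    let: (i1, i2) := mxtens_unindex i in
    let: (j1, j2) := mxtens_unindex j in
    \sum_(k < n) A (mxtens_index (mxtens_index (i1, k), i2))
                   (mxtens_index (mxtens_index (j1, k), j2)).

(* (id_k (x) N)(X), where X = \sum_(i, j) |i><j| (x) X_ij.                     *)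
Definition amplify k m n (N : 'M[C]_m -> 'M[C]_n) (X : 'M[C]_(k * m)) :
    'M[C]_(k * n) :=
  \sum_(i < k) \sum_(j < k)
    delta_mx i j *t
    N (\matrix_(a, b) X (mxtens_index (i, a)) (mxtens_index (j, b))).

End Operators.

Section Channels.
Variables (R : realType) (dA dB : nat).
Local Notation C := R[i].

Definition completely_positive (N : 'M[C]_dA -> 'M[C]_dB) : Prop :=
  forall (k : nat) (X : 'M[C]_(k * dA)), psdmx X -> psdmx (amplify N X).

Definition trace_preserving (N : 'M[C]_dA -> 'M[C]_dB) : Prop :=
  forall X : 'M[C]_dA, \tr (N X) = \tr X.

Definition cptp (N : {linear 'M[C]_dA -> 'M[C]_dB}) : Prop :=
  completely_positive N /\ trace_preserving N.

Definition kraus_rep (N : 'M[C]_dA -> 'M[C]_dB) (Ks : seq 'M[C]_(dB, dA)) :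
    Prop :=
  forall X : 'M[C]_dA, N X = \sum_(K <- Ks) K *m X *m K ^t Num.conj.

(* M = N^*. The second conjunct makes the complex conjugate independent of    *)
(* the Kraus representation of N; the first one prevents it from being        *)
(* vacuous.                                                                   *)
Definition complex_conjugate (N M : 'M[C]_dA -> 'M[C]_dB) : Prop :=
  (exists Ks, kraus_rep N Ks) /\
  (forall Ks, kraus_rep N Ks ->
     forall X : 'M[C]_dA, M X = \sum_(K <- Ks) map_mx Num.conj K *m X *m K^T).

Definition choi (N : 'M[C]_dA -> 'M[C]_dB) : 'M[C]_(dA * dB) :=
  \sum_(i < dA) \sum_(j < dA) delta_mx i j *t N (delta_mx i j).

(* The linear map whose Choi operator is J (see unchoiK and choiK).           *)
Definition unchoi (J : 'M[C]_(dA * dB)) (X : 'M[C]_dA) : 'M[C]_dB :=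
  ptrace_l ((X^T *t 1%:M) *m J).

Lemma unchoi_is_linear J : linear (unchoi J).
Proof.
move=> a X Y; apply/matrixP=> i j; rewrite !mxE mulr_sumr -big_split /=.
apply: eq_bigr => k _; rewrite !mxE mulr_sumr -big_split /=.
apply: eq_bigr => l _; rewrite !mxE !mxtens_indexK /=.
by rewrite !mulrDl -!mulrA.
Qed.

HB.instance Definition _ J :=
  GRing.isLinear.Build C 'M[C]_dA 'M[C]_dB _ (unchoi J) (unchoi_is_linear J).

Lemma choiE N i j a b :
  choi N (mxtens_index (i, a)) (mxtens_index (j, b)) = N (delta_mx i j) a b.
Proof.
rewrite /choi summxE (bigD1 i) //= [X in _ + X]big1 ?addr0 => [|k nki].
  rewrite summxE (bigD1 j) //= [X in _ + X]big1 ?addr0 => [|l nlj].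
    by rewrite tensmxE !mxE !eqxx mul1r.
  by rewrite tensmxE !mxE (eq_sym j) (negbTE nlj) andbF mul0r.
rewrite summxE big1 // => l _.
by rewrite tensmxE !mxE (eq_sym i) (negbTE nki) mul0r.
Qed.

Lemma unchoiE J X a b :
  unchoi J X a b =
  \sum_(i < dA) \sum_(j < dA)
    X i j * J (mxtens_index (i, a)) (mxtens_index (j, b)).
Proof.
rewrite !mxE exchange_big /=; apply: eq_bigr => j _; rewrite !mxE.
rewrite (reindex (@mxtens_index dA dB)) /=; last first.
  by exists (@mxtens_unindex dA dB) => x _;
    rewrite ?mxtens_indexK ?mxtens_unindexK.
rewrite (eq_bigr (fun p => (X p.1 j * (a == p.2)%:R)
    * J (mxtens_index (p.1, p.2)) (mxtens_index (j, b)))); last first.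
  by move=> [i l] _; rewrite tensmxE !mxE.
rewrite -(pair_bigA _ (fun i l => (X i j * (a == l)%:R)
    * J (mxtens_index (i, l)) (mxtens_index (j, b)))) /=.
apply: eq_bigr => i _; rewrite (bigD1 a) //= eqxx mulr1.
rewrite [X in _ + X]big1 ?addr0 // => l /negbTE nla.
by rewrite eq_sym nla mulr0 mul0r.
Qed.

Lemma unchoiK J : choi (unchoi J) = J.
Proof.
apply/matrixP=> x y; case: (mxtens_indexP x) => i a.
case: (mxtens_indexP y) => j b; rewrite choiE unchoiE.
rewrite (bigD1 i) //= [X in _ + X]big1 ?addr0 => [|k /negbTE nki].
  rewrite (bigD1 j) //= [X in _ + X]big1 ?addr0 => [|l /negbTE nlj].
    by rewrite mxE !eqxx mul1r.
  by rewrite mxE nlj andbF mul0r.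
by rewrite big1 // => l _; rewrite mxE nki mul0r.
Qed.

Lemma choiK (N : {linear 'M[C]_dA -> 'M[C]_dB}) X : unchoi (choi N) X = N X.
Proof.
apply/matrixP=> a b; rewrite unchoiE [in RHS](matrix_sum_delta X).
rewrite linear_sum summxE; apply: eq_bigr => i _.
rewrite linear_sum summxE; apply: eq_bigr => j _.
by rewrite choiE linearZ mxE.
Qed.

End Channels.

Section Supermaps.
Variables (R : realType) (dA dB : nat).
Local Notation C := R[i].

(* A supermap is given by its Choi operator on ((A' (x) A) (x) B) (x) B',     *)
(* where A' and B' are copies of A and B.                                     *)
Definition supermap : Type := 'M[C]_(dA * dA * dB * dB).

Definition assoc_eq : (dA * (dA * dB) * dB = dA * dA * dB * dB)%N :=
  congr1 (muln^~ dB) (mulnA dA dA dB).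

(* J_AB (x) 1_A'B', with the factors in the order A'ABB'.                      *)
Definition embed_AB (J : 'M[C]_(dA * dB)) : 'M[C]_(dA * dA * dB * dB) :=
  castmx (assoc_eq, assoc_eq)
    ((1%:M : 'M[C]_dA) *t J *t (1%:M : 'M[C]_dB)).

(* The two traces are over B, then over A.                                    *)
Definition apply_supermap (S : supermap) (N : 'M[C]_dA -> 'M[C]_dB) :
    'M[C]_dA -> 'M[C]_dB :=
  unchoi (ptrace_m (ptrace_m (S *m embed_AB (choi N)^T))).

Definition quantum_comb (S : supermap) : Prop :=
  [/\ psdmx S,
      ptrace_r S =
        ptrace_r (ptrace_r S) *t ((dB%:R^-1 : C) *: (1%:M : 'M[C]_dB))
    & ptrace_m (ptrace_r S) = 1%:M].

Definition virtual_comb (S : supermap) : Prop :=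
  exists (k : nat) (alpha : 'I_k -> R) (Cs : 'I_k -> supermap),
    [/\ \sum_(i < k) alpha i = 1,
        forall i, quantum_comb (Cs i)
      & S = \sum_(i < k) (alpha i)%:C *: (Cs i : 'M[C]_(dA * dA * dB * dB))].

End Supermaps.

(* Main.v *)
(* The transposition J |-> J^T of Choi operators is the supermap with Choi    *)
(* operator F_{A'A} (x) F_{BB'}, F being the flip. This operator is not       *)
(* positive, but it is an affine combination of combs (see swap_virtual). A   *)
(* map with Kraus operators K_j has Choi operator sum_j v_j v_j^dagger, where *)
(* v_j lists the entries of K_j, so that transposing it conjugates every K_j; *)
(* Kraus operators exist by the spectral theorem for the Choi operator.       *)

Require Import Defs.
From mathcomp Require Import all_boot all_order all_algebra.
From mathcomp Require Import fingroup perm spectral.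
From mathcomp Require Import ring lra.
From mathcomp Require Import reals complex mxtens.

Set Implicit Arguments.
Unset Strict Implicit.
Unset Printing Implicit Defensive.

Import Order.TTheory GRing.Theory Num.Theory.
Local Open Scope ring_scope.
Local Open Scope sesquilinear_scope.

(** By [kraus_unchoi_tr], conjugating any Kraus family of a map transposes its Choi operator, and by
    [apply_swap] the flip F on A'A and BB' effects this transposition. It remains to see that F is a
    virtual comb. For x 1 + y F both trace conditions of a comb follow from the single affine
    equation x dA dB + y = 1 ([swap_comb_quantum]), which F satisfies. As F is a Hermitian
    involution, 1 + F and 2 + F are positive; rescaled onto this line they give two combs, and 2 (1
    + F) - (2 + F) = F expresses F through them ([swap_virtual]). *)

(** * Positive semidefinite matrices *)

Section PositiveSemidefinite.
Variable R : realType.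
Local Notation C := R[i].

Lemma psdmx_gram m n (B : 'M[C]_(m, n)) : psdmx (B ^t Num.conj *m B).
Proof.
move=> u; rewrite mulmxA -map_mxM -trmx_mul -mulmxA.
rewrite mxE sumr_ge0 // => k _; rewrite !mxE mulrC.
exact: mul_conjC_ge0.
Qed.

Lemma psdmxD n (A B : 'M[C]_n) : psdmx A -> psdmx B -> psdmx (A + B).
Proof.
by move=> hA hB u; rewrite mulmxDr mulmxDl mxE addr_ge0 ?hA ?hB.
Qed.

Lemma psdmxZ n (c : C) (A : 'M[C]_n) : 0 <= c -> psdmx A -> psdmx (c *: A).
Proof.
by move=> hc hA u; rewrite -scalemxAr -scalemxAl mxE mulr_ge0 ?hA.
Qed.

Lemma psdmx1 n : psdmx (1%:M : 'M[C]_n).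
Proof.
by have := psdmx_gram (1%:M : 'M[C]_n); rewrite trmx1 map_mx1 mulmx1.
Qed.

Lemma delta_formE n (A : 'M[C]_n) i j :
  ((delta_mx i (0 : 'I_1)) ^t Num.conj *m A *m delta_mx j (0 : 'I_1)) 0 0 =
  A i j.
Proof. by rewrite trmx_delta map_delta_mx -rowE -colE !mxE. Qed.

(** Polarization over the complex numbers: the form at e_i + c e_j, for c = 1 and c = 'i, isolates
    the off-diagonal entries. *)
Lemma form_eq0 n (B : 'M[C]_n) :
  (forall u : 'cV[C]_n, (u ^t Num.conj *m B *m u) 0 0 = 0) -> B = 0.
Proof.
move=> hB; apply/matrixP=> i j; rewrite [RHS]mxE.
have diag0 k : B k k = 0 by rewrite -delta_formE hB.
have polar (c : C) : c * B i j + c^* * B j i = 0.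
  have := hB (delta_mx i 0 + c *: delta_mx j 0).
  have -> : (delta_mx i 0 + c *: delta_mx j 0) ^t Num.conj =
      (delta_mx i (0 : 'I_1)) ^t Num.conj
      + c^* *: (delta_mx j (0 : 'I_1)) ^t Num.conj.
    by apply/matrixP=> k l; rewrite !mxE rmorphD rmorphM.
  rewrite !mulmxDl !mulmxDr.
  rewrite -!scalemxAl -!scalemxAr.
  move: (delta_formE B j j) (delta_formE B j i) (delta_formE B i j)
    (delta_formE B i i).
  move: (_ *m _ *m _) (_ *m _ *m _) (_ *m _ *m _) (_ *m _ *m _) => X1 X2 X3 X4.
  rewrite !diag0 => e1 e2 e3 e4.
  by rewrite !mxE e1 e2 e3 e4 !mulr0 addr0 add0r => <-.
have := polar 1; rewrite conjC1 !mul1r => /eqP; rewrite addr_eq0 => /eqP e.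
have := polar 'i; rewrite conjCi e mulrN mulNr -opprD -mulr2n => /eqP.
rewrite oppr_eq0 mulrn_eq0 mulf_eq0 (negbTE (neq0Ci _)) => /eqP ->.
by rewrite oppr0.
Qed.

(** Nonnegative values are real, so [A] and its adjoint have the same quadratic form. *)
Lemma psdmx_hermitian n (A : 'M[C]_n) : psdmx A -> A ^t Num.conj = A.
Proof.
move=> hA; apply/eqP; rewrite -subr_eq0; apply/eqP/form_eq0 => u.
rewrite mulmxBr mulmxBl mxE [X in _ + X]mxE; apply/eqP.
rewrite subr_eq0; apply/eqP.
have /ger0_real/CrealP <- := hA u.
have -> (M : 'M[C]_1) : (M 0 0)^* = (M ^t Num.conj) 0 0 by rewrite !mxE.
by rewrite !trmx_mul !map_mxM trmxCK mulmxA.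
Qed.

(** Spectral theorem: each eigenvalue is the form at a unit eigenvector, hence nonnegative, and its
    square root is absorbed into that vector. *)
Lemma psdmx_rank1_sum n (A : 'M[C]_n) : psdmx A ->
  exists v : 'I_n -> 'cV[C]_n, A = \sum_k v k *m (v k) ^t Num.conj.
Proof.
move=> hA.
have /orthomx_spectralP : A \is normalmx.
  by apply/normalmxP; rewrite psdmx_hermitian.
rewrite invmx_unitary ?spectral_unitarymx //.
set U := spectralmx A; set d := spectral_diag A => eA.
have /unitarymxP UU : U \is unitarymx := spectral_unitarymx A.
have d_ge0 k : 0 <= d 0 k.
  have := hA (U ^t Num.conj *m delta_mx k 0).
  rewrite {1}eA trmx_mul map_mxM trmxCK !mulmxA.
  rewrite -(mulmxA _ U) UU mulmx1 -(mulmxA _ U) UU mulmx1.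
  by rewrite delta_formE mxE eqxx mulr1n.
exists (fun k => sqrtC (d 0 k) *: (row k U) ^t Num.conj).
rewrite {1}eA; apply/matrixP=> i j; rewrite mxE summxE.
apply: eq_bigr => k _.
rewrite mul_mx_diag !mxE big_ord1 !mxE.
rewrite rmorphM /= conjCK (CrealP _ : (sqrtC (d 0 k))^* = _); last first.
  by rewrite ger0_real ?sqrtC_ge0.
by rewrite mulrACA -expr2 sqrtCK mulrCA mulrA.
Qed.

End PositiveSemidefinite.

(** * Choi operators and Kraus representations *)

Section Kraus.
Variables (R : realType) (dA dB : nat).
Local Notation C := R[i].

Lemma psdmx_choi (N : 'M[C]_dA -> 'M[C]_dB) :
  completely_positive N -> psdmx (choi N).
Proof.
move=> cpN.
(* The unnormalized maximally entangled vector; amplifying [N] on its projector gives the Choi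
   operator. *)
pose w : 'rV[C]_(dA * dA) :=
  \row_x ((mxtens_unindex x).1 == (mxtens_unindex x).2)%:R.
have <- : amplify N (w ^t Num.conj *m w) = choi N.
  rewrite /amplify /choi; apply: eq_bigr => i _; apply: eq_bigr => j _.
  congr (_ *t N _); apply/matrixP=> a b.
  rewrite !mxE big_ord1 !mxE !mxtens_indexK /= conjC_nat -natrM mulnb.
  by rewrite (eq_sym i) (eq_sym j).
exact/cpN/psdmx_gram.
Qed.

Lemma kraus_entryE (Ks : seq 'M[C]_(dB, dA)) X a b :
  (\sum_(K <- Ks) K *m X *m K ^t Num.conj) a b =
  \sum_i \sum_j X i j * \sum_(K <- Ks) K a i * (K b j)^*.
Proof.
transitivity (\sum_(K <- Ks) \sum_i \sum_j X i j * (K a i * (K b j)^*)).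
  rewrite summxE; apply: eq_bigr => K _; rewrite exchange_big mxE.
  apply: eq_bigr => j _; rewrite !mxE mulr_suml; apply: eq_bigr => i _.
  by rewrite mulrAC mulrC.
rewrite exchange_big; apply: eq_bigr => i _.
rewrite exchange_big; apply: eq_bigr => j _.
by rewrite mulr_sumr.
Qed.

Lemma kraus_choiE (N : 'M[C]_dA -> 'M[C]_dB) (Ks : seq 'M[C]_(dB, dA))
    i j a b : kraus_rep N Ks ->
  choi N (mxtens_index (i, a)) (mxtens_index (j, b)) =
  \sum_(K <- Ks) K a i * (K b j)^*.
Proof.
move=> hK; rewrite choiE hK kraus_entryE.
rewrite (bigD1 i) //= [X in _ + X]big1 ?addr0 => [|k /negbTE nki].
  rewrite (bigD1 j) //= [X in _ + X]big1 ?addr0 => [|l /negbTE nlj].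
    by rewrite mxE !eqxx mul1r.
  by rewrite mxE nlj andbF mul0r.
by rewrite big1 // => l _; rewrite mxE nki mul0r.
Qed.

(** Each vector of a rank-one decomposition of the Choi operator, reshaped into a matrix, is a Kraus
    operator. *)
Lemma kraus_exists (N : {linear 'M[C]_dA -> 'M[C]_dB}) :
  completely_positive N -> exists Ks, kraus_rep N Ks.
Proof.
move=> /psdmx_choi /psdmx_rank1_sum[v choi_v].
exists [seq \matrix_(a, i) v k (mxtens_index (i, a)) 0 | k : 'I_(dA * dB)] => X.
apply/matrixP=> a b; rewrite kraus_entryE -choiK unchoiE.
apply: eq_bigr => i _; apply: eq_bigr => j _; congr (_ * _).
rewrite choi_v summxE big_image; apply: eq_bigr => k _.
by rewrite !mxE big_ord1 !mxE.
Qed.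

(** Conjugating every K conjugates the Choi entries, the sums of K a i * (K b j)^*, which amounts to
    exchanging (i, a) with (j, b). *)
Lemma kraus_unchoi_tr (N : 'M[C]_dA -> 'M[C]_dB) Ks X : kraus_rep N Ks ->
  unchoi (choi N)^T X = \sum_(K <- Ks) map_mx Num.conj K *m X *m K^T.
Proof.
move=> hK; apply/matrixP=> a b; rewrite unchoiE.
have -> : \sum_(K <- Ks) map_mx Num.conj K *m X *m K^T =
    \sum_(K <- [seq map_mx Num.conj K | K <- Ks]) K *m X *m K ^t Num.conj.
  rewrite big_map; apply: eq_bigr => K _; congr (_ *m _).
  by apply/matrixP=> i j; rewrite !mxE conjCK.
rewrite kraus_entryE; apply: eq_bigr => i _; apply: eq_bigr => j _.
rewrite mxE (kraus_choiE _ _ _ _ hK) big_map; congr (_ * _).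
by apply: eq_bigr => K _; rewrite !mxE conjCK mulrC.
Qed.

End Kraus.

(** * The flip and its decomposition into combs *)

Section SwapComb.
Variables (R : realType) (dA dB : nat).
Local Notation C := R[i].
Local Notation D := (dA * dA * dB * dB)%N.

Definition idx4 (a' a : 'I_dA) (b b' : 'I_dB) : 'I_D :=
  mxtens_index (mxtens_index (mxtens_index (a', a), b), b').

Lemma idx4_ind (P : 'I_D -> Prop) :
  (forall a' a b b', P (idx4 a' a b b')) -> forall x, P x.
Proof.
move=> h x; case: (mxtens_indexP x) => y b'; case: (mxtens_indexP y) => z b.
by case: (mxtens_indexP z) => a' a; apply: h.
Qed.

Lemma idx4_eq a' a b b' c' c d d' :
  (idx4 a' a b b' == idx4 c' c d d') =
  [&& a' == c', a == c, b == d & b' == d'].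
Proof.
rewrite /idx4 !(can_eq (@mxtens_indexK _ _)) -!pair_eqE /=.
by rewrite !(can_eq (@mxtens_indexK _ _)) -!pair_eqE /=
  !(can_eq (@mxtens_indexK _ _)) -!pair_eqE /= !andbA.
Qed.

Definition swap_idx (x : 'I_D) : 'I_D :=
  let: (y, b') := mxtens_unindex x in
  let: (z, b) := mxtens_unindex y in
  let: (a', a) := mxtens_unindex z in
  idx4 a a' b' b.

Lemma swap_idxE a' a b b' : swap_idx (idx4 a' a b b') = idx4 a a' b' b.
Proof. by rewrite /swap_idx /idx4 !mxtens_indexK. Qed.

Lemma swap_idxK : involutive swap_idx.
Proof. by apply: idx4_ind => a' a b b'; rewrite !swap_idxE. Qed.

(** As a permutation matrix, the flip inherits its square and its adjoint from the involution
    [swap_idx]. *)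
Definition swap_perm : 'S_D := perm (can_inj swap_idxK).

(* F_{A'A} (x) F_{BB'}, with F the flip. *)
Definition swap_mx : 'M[C]_D := perm_mx swap_perm.

Lemma swap_mxE a' a b b' c' c d d' :
  swap_mx (idx4 a' a b b') (idx4 c' c d d') =
  [&& a == c', a' == c, b' == d & b == d']%:R.
Proof. by rewrite !mxE permE swap_idxE idx4_eq. Qed.

Lemma swap_mx_sqr : swap_mx *m swap_mx = 1%:M.
Proof.
rewrite -perm_mxM -perm_mx1; congr perm_mx.
by apply/permP=> x; rewrite permM !permE swap_idxK.
Qed.

Lemma swap_mx_herm : swap_mx ^t Num.conj = swap_mx.
Proof.
rewrite tr_perm_mx map_perm_mx; congr perm_mx; apply/permP=> x.
by apply: (@perm_inj _ swap_perm); rewrite permKV !permE swap_idxK.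
Qed.

(** Since F is Hermitian with F^2 = 1, (1 + F)^2 = 2 (1 + F), so 1 + F is half a Gram matrix. *)
Lemma psdmx_1D_swap : psdmx (1%:M + swap_mx).
Proof.
have h : (1%:M + swap_mx) ^t Num.conj = 1%:M + swap_mx.
  by rewrite linearD map_mxD /= swap_mx_herm trmx1 map_mx1.
have -> : 1%:M + swap_mx =
    2^-1 *: ((1%:M + swap_mx) ^t Num.conj *m (1%:M + swap_mx)).
  rewrite h mulmxDl !mulmxDr !mulmx1 !mul1mx swap_mx_sqr [swap_mx + _]addrC.
  by rewrite -mulr2n -[X in _ *: X]scaler_nat scalerA mulVf ?pnatr_eq0 ?scale1r.
by apply: psdmxZ; [rewrite invr_ge0 ler0n | apply: psdmx_gram].
Qed.

Definition swap_comb (x y : C) : supermap R dA dB := x *: 1%:M + y *: swap_mx.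

Lemma swap_combE x y a' a b b' c' c d d' :
  swap_comb x y (idx4 a' a b b') (idx4 c' c d d') =
  x * [&& a' == c', a == c, b == d & b' == d']%:R +
  y * [&& a == c', a' == c, b' == d & b == d']%:R.
Proof.
by rewrite mxE [X in X + _]mxE [X in _ + X]mxE swap_mxE mxE idx4_eq.
Qed.

(** Tracing out B' turns 1_BB' into dB 1_B and the flip of BB' into 1_B; the common factor 1_B is
    what the first trace condition asks for. *)
Lemma ptrace_r_swap_combE x y a' a b c' c d :
  ptrace_r (swap_comb x y : 'M[C]_D)
    (mxtens_index (mxtens_index (a', a), b))
    (mxtens_index (mxtens_index (c', c), d)) =
  (x * dB%:R * ((a' == c') && (a == c))%:R + y * ((a == c') && (a' == c))%:R) *
  (b == d)%:R.
Proof.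
rewrite mxE (eq_bigr _ (fun b' _ => swap_combE x y a' a b b' c' c d b')).
rewrite big_split -!mulr_sumr mulrDl /=; congr (_ + _); last first.
  rewrite -mulrA -natrM mulnb; congr (_ * _).
  rewrite (bigD1 d) //= eqxx big1 ?addr0 => [|k /negbTE ->].
    by rewrite andbA.
  by rewrite !andbF.
rewrite -!mulrA; congr (_ * _); rewrite -natrM mulnb.
under eq_bigr do rewrite eqxx andbT andbA.
by rewrite sumr_const card_ord mulr_natl.
Qed.

(** Tracing out A as well turns 1_A'A into dA 1_A' and the flip of A'A into 1_A', leaving the
    identity times x dA dB + y. *)
Lemma swap_comb_quantum (x y : C) :
  psdmx (swap_comb x y : 'M[C]_D) -> x * (dA * dB)%:R + y = 1 ->
  quantum_comb (swap_comb x y).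
Proof.
move=> psd xy1; split=> //.
- apply/matrixP=> i j; case: (mxtens_indexP i) => z b.
  case: (mxtens_indexP z) => a' a; case: (mxtens_indexP j) => w d.
  case: (mxtens_indexP w) => c' c.
  rewrite ptrace_r_swap_combE tensmxE mxE.
  under eq_bigr do rewrite ptrace_r_swap_combE eqxx mulr1.
  rewrite sumr_const card_ord -[(_ + _) *+ _]mulr_natr !mxE mulrA mulfK //.
  (* The index [b] itself witnesses that [dB] is nonzero. *)
  by rewrite pnatr_eq0 -lt0n (leq_ltn_trans _ (ltn_ord b)).
- apply/matrixP=> i j; case: (mxtens_indexP i) => a' b.
  case: (mxtens_indexP j) => c' d; rewrite [RHS]mxE mxE !mxtens_indexK.
  under eq_bigr do rewrite ptrace_r_swap_combE eqxx andbT.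
  rewrite -mulr_suml big_split -!mulr_sumr sumr_const card_ord /=.
  rewrite (bigD1 c') //= eqxx big1 ?addr0 => [|k /negbTE -> //].
  rewrite (can_eq (@mxtens_indexK _ _)) -pair_eqE /=.
  rewrite -mulnb natrM; congr (_ * _).
  rewrite -[RHS]mul1r -[X in _ = X * _]xy1 mulrDl; congr (_ + _).
  by rewrite -[_ *+ dA]mulr_natl natrM -!mulrA [_%:R * (_ * _)]mulrCA.
Qed.

Lemma embed_ABE (J : 'M[C]_(dA * dB)) a' a b b' c' c d d' :
  embed_AB J (idx4 a' a b b') (idx4 c' c d d') =
  (a' == c')%:R * J (mxtens_index (a, b)) (mxtens_index (c, d)) *
  (b' == d')%:R.
Proof.
rewrite castmxE.
(* Both bracketings of the tensor product number the basis alike. *)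
have castE e (p' p : 'I_dA) (q q' : 'I_dB) : cast_ord e (idx4 p' p q q') =
    mxtens_index (mxtens_index (p', mxtens_index (p, q)), q').
  apply: val_inj => /=; congr (_ * _ + _)%N.
  by rewrite mulnDl mulnA addnA.
by rewrite !castE !tensmxE !mxE.
Qed.

(** Contracting with the flips of A'A and BB' merely relabels AB as A'B' in the transposed Choi
    operator. *)
Lemma apply_swap (N : 'M[C]_dA -> 'M[C]_dB) :
  apply_supermap (swap_mx : supermap R dA dB) N = unchoi (choi N)^T.
Proof.
rewrite /apply_supermap; congr unchoi.
set J := (choi N)^T; apply/matrixP=> i j.
case: (mxtens_indexP i) => a' b'; case: (mxtens_indexP j) => c' d'.
rewrite mxE !mxtens_indexK.
have entryE a : ptrace_m (swap_mx *m embed_AB J)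
    (mxtens_index (mxtens_index (a', a), b'))
    (mxtens_index (mxtens_index (c', a), d')) =
  \sum_b (a == c')%:R * J (mxtens_index (a', b')) (mxtens_index (a, b)) *
    (b == d')%:R.
  rewrite mxE !mxtens_indexK; apply: eq_bigr => b _.
  rewrite -!/(idx4 _ _ _ _) -row_permE mxE permE swap_idxE.
  exact: embed_ABE.
under eq_bigr do rewrite entryE.
rewrite (bigD1 c') //= [X in _ + X]big1 ?addr0 => [|a /negbTE nac].
  rewrite (bigD1 d') //= big1 ?addr0 => [|b /negbTE ->].
    by rewrite !eqxx mulr1 mul1r.
  by rewrite mulr0.
by rewrite big1 // => b _; rewrite nac !mul0r.
Qed.

Lemma swap_combD (p q x y z t : C) :
  p *: (swap_comb x y : 'M[C]_D) + q *: swap_comb z t =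
  swap_comb (p * x + q * z) (p * y + q * t).
Proof. by rewrite /swap_comb !scalerDr !scalerA addrACA -!scalerDl. Qed.

(* The flip satisfies both partial trace conditions but is not positive. On   *)
(* the line x * (dA * dB) + y = 1 of matrices x 1 + y F satisfying them, it   *)
(* is an affine combination of the points proportional to 1 + F and 2 + F,    *)
(* which are positive. These points exist also when dA * dB = 0.              *)
Lemma swap_virtual : virtual_comb (swap_mx : supermap R dA dB).
Proof.
pose t : R := (dA * dB)%:R; have t_ge0 : 0 <= t by rewrite ler0n.
have t1_gt0 : 0 < 1 + t by rewrite ltr_pwDl.
have t2_gt0 : 0 < 1 + 2 * t by rewrite ltr_pwDl // mulr_ge0.
pose u := (1 + t)^-1; pose v := (1 + 2 * t)^-1.
have u_ge0 : 0 <= u%:C%C by rewrite lecR invr_ge0 ltW.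
have v_ge0 : 0 <= v%:C%C by rewrite lecR invr_ge0 ltW.
(* The weights undo the normalizations [u] of 1 + F and [v] of 2 + F, with the factors 2 and -1 that
   cancel the identity; they sum to 1. *)
pose alpha (i : 'I_2) : R := if i == 0 then 2 * (1 + t) else - (1 + 2 * t).
pose Cs (i : 'I_2) : supermap R dA dB :=
  if i == 0 then swap_comb u%:C%C u%:C%C else swap_comb (2 * v)%:C%C v%:C%C.
have tE : (dA * dB)%:R = t%:C%C by rewrite rmorph_nat.
exists 2%N, alpha, Cs; split.
- by rewrite big_ord_recl big_ord1 /alpha /=; ring.
- move=> i; rewrite /Cs; case: ifP => _; apply: swap_comb_quantum.
  + rewrite /swap_comb -scalerDr; apply: psdmxZ => //; exact: psdmx_1D_swap.
  + by rewrite tE -rmorphM -rmorphD /= /u; congr (_%:C%C); field; lra.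
  (* Split 2 + F as 1 + (1 + F), a sum of two positive matrices. *)
  + rewrite /swap_comb mulr_natl rmorphMn mulr2n scalerDl -addrA -scalerDr.
    apply: psdmxD; first exact/psdmxZ/psdmx1.
    by apply: psdmxZ => //; exact: psdmx_1D_swap.
  + by rewrite tE -rmorphM -rmorphD /= /v; congr (_%:C%C); field; lra.
rewrite big_ord_recl big_ord1 /alpha /Cs /= swap_combD.
rewrite -!(rmorphM (real_complex R)) -!(rmorphD (real_complex R)) /=.
have -> : 2 * (1 + t) * u + - (1 + 2 * t) * (2 * v) = 0.
  by rewrite /u /v; field; lra.
have -> : 2 * (1 + t) * u + - (1 + 2 * t) * v = 1.
  by rewrite /u /v; field; lra.
by rewrite /swap_comb scale0r add0r scale1r.
Qed.

End SwapComb.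

Theorem theorem3 (R : realType) (dA dB : nat) :
  exists S : supermap R dA dB,
    virtual_comb S /\
    forall N : {linear 'M[R[i]]_dA -> 'M[R[i]]_dB},
      cptp N -> complex_conjugate N (apply_supermap S N).
Proof.
exists (swap_mx R dA dB); split; first exact: swap_virtual.
move=> N [cpN _]; split; first exact: kraus_exists.
by move=> Ks hK X; rewrite apply_swap; apply: kraus_unchoi_tr.
Qed.
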